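(* Let $\mathbf{k}$ be a commutative ring, let $k>0$ and $n\geq k$ be integers, and let $a_1,a_2,\ldots,a_k\in\mathbf{k}$. Let $\mathcal{S}$ be the ring of symmetric polynomials in $\mathbf{k}[x_1,\ldots,x_k]$, and let $I$ be the ideal of $\mathcal{S}$ generated by $h_{n-k+1}-a_1,\ h_{n-k+2}-a_2,\ \ldots,\ h_n-a_k$. Let $V$ be the set of all $k$-tuples $(-n,\tau_2,\tau_3,\ldots,\tau_k)\in\mathbb{Z}^k$ satisfying $\tau_i\in\{0,1\}$ for each $i\in\{2,3,\ldots,k\}$. Let $\mu$ be a partition with at most $k$ parts (regarded as a $k$-tuple in $\mathbb{N}^k$) such that $\mu_1>n-k$. Then, in $\mathcal{S}/I$, \[ \overline{s_\mu}=\sum_{j=1}^{k}(-1)^{k-j}a_j\sum_{\substack{\tau\in V;\\ -|\tau|=n-k+j}}\overline{s_{\mu+\tau}}. \]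
   Context: For $m\in\mathbb{Z}$, $h_m$ is the $m$-th complete homogeneous symmetric polynomial in $x_1,\ldots,x_k$ (with $h_0=1$, and $h_m=0$ for $m<0$). For any $\lambda=(\lambda_1,\ldots,\lambda_k)\in\mathbb{Z}^k$, define $s_\lambda=\det\left((h_{\lambda_u-u+v})_{1\leq u\leq k,\ 1\leq v\leq k}\right)\in\mathcal{S}$; when $\lambda$ is a partition with at most $k$ parts, this is the usual Schur polynomial $s_\lambda(x_1,\ldots,x_k)$. Addition on $\mathbb{Z}^k$ is entrywise, and $|\tau|$ denotes the sum of the entries of $\tau\in\mathbb{Z}^k$. $\overline{m}$ denotes the residue class of $m\in\mathcal{S}$ in $\mathcal{S}/I$. *)

(* Defs.v *)
From HB Require Import structures.
From mathcomp Require Import all_boot all_order all_algebra.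
From mathcomp Require Import finmap mathcomp_extra boolp classical_sets.
From mathcomp Require Import functions cardinality fsbigop.
From mathcomp Require Import freeg mpoly.

Set Implicit Arguments.
Unset Strict Implicit.
Unset Printing Implicit Defensive.

Import Order.TTheory GRing.Theory Num.Theory.

Local Open Scope classical_set_scope.
Local Open Scope ring_scope.
Local Open Scope quotient_scope.

Record sympoly (k : nat) (R : comNzRingType) := SymPoly {
  sympoly_val :> {mpoly R[k]};
  _ : @symmetric_pred k R sympoly_val }.

Section SympolyRing.
Variables (k : nat) (R : comNzRingType).

HB.instance Definition _ := [isSub for @sympoly_val k R].
HB.instance Definition _ := [Choice of sympoly k R by <:].
HB.instance Definition _ :=
  [SubChoice_isSubComNzRing of sympoly k R by <:].
HB.instance Definition _ := [SubZmodule_isSubLmodule of sympoly k R by <:].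
HB.instance Definition _ :=
  [SubNzRing_SubLmodule_isSubLalgebra of sympoly k R by <:].
HB.instance Definition _ := GRing.Lalgebra_isComAlgebra.Build R (sympoly k R).

End SympolyRing.

(** The quotients of [ring_quotient] are nonzero rings, so they require a proof
    that the ideal is proper; here the quotient may be the zero ring. *)

Section IdealQuotient.
Variables (R : comNzRingType) (A : comAlgType R) (m : nat) (g : 'I_m -> A).

Definition gen_ideal : pred A :=
  fun p => `[< exists c : 'I_m -> A, p = \sum_(i < m) c i * g i >].

Lemma gen_idealP p :
  reflect (exists c : 'I_m -> A, p = \sum_(i < m) c i * g i) (p \in gen_ideal).
Proof. exact: asboolP. Qed.

Lemma gen_ideal_zmod : zmod_closed gen_ideal.
Proof.
split=> [|p q /gen_idealP[c ->] /gen_idealP[d ->]]; apply/gen_idealP.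
  by exists (fun=> 0); rewrite big1 // => i _; rewrite mul0r.
exists (fun i => c i - d i); rewrite -sumrB.
by apply: eq_bigr => i _; rewrite mulrBl.
Qed.

HB.instance Definition _ := GRing.isZmodClosed.Build A gen_ideal gen_ideal_zmod.

Lemma gen_idealMl p q : q \in gen_ideal -> p * q \in gen_ideal.
Proof.
move=> /gen_idealP[c ->]; apply/gen_idealP; exists (fun i => p * c i).
by rewrite mulr_sumr; apply: eq_bigr => i _; rewrite mulrA.
Qed.

Definition ideal_quot := Quotient.quot (GRing.ZmodClosed.clone A gen_ideal _).

HB.instance Definition _ := Choice.on ideal_quot.
HB.instance Definition _ := EqQuotient.on ideal_quot.
HB.instance Definition _ := GRing.Zmodule.on ideal_quot.

Definition quot_class (p : A) : ideal_quot := \pi_ideal_quot p.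

Lemma quot_classP p q :
  reflect (quot_class p = quot_class q) (p - q \in gen_ideal).
Proof. by rewrite Quotient.idealrBE; apply: eqP. Qed.

Lemma quot_class_is_zmod_morphism : zmod_morphism quot_class.
Proof. exact: (raddfB (\pi_ideal_quot)). Qed.

HB.instance Definition _ :=
  GRing.isZmodMorphism.Build A ideal_quot quot_class
    quot_class_is_zmod_morphism.

Definition quot_mul (x y : ideal_quot) : ideal_quot :=
  quot_class (repr x * repr y).
Definition quot_scale (c : R) (x : ideal_quot) : ideal_quot :=
  quot_class (c *: repr x).

Lemma quot_class_repr (x : ideal_quot) : quot_class (repr x) = x.
Proof. exact: (@reprK A ideal_quot). Qed.

Lemma quot_class_mul p q :
  quot_class (p * q) = quot_mul (quot_class p) (quot_class q).
Proof.
have h r : r - repr (quot_class r) \in gen_ideal.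
  by apply/quot_classP; rewrite quot_class_repr.
apply/quot_classP.
have -> : p * q - repr (quot_class p) * repr (quot_class q) =
    p * (q - repr (quot_class q)) + repr (quot_class q) * (p - repr (quot_class p)).
  by rewrite !mulrBr addrA [repr _ * p]mulrC subrK [repr _ * repr _]mulrC.
by rewrite rpredD ?gen_idealMl.
Qed.

Lemma quot_class_scale c p :
  quot_class (c *: p) = quot_scale c (quot_class p).
Proof.
apply/quot_classP; rewrite -scalerBr -mulr_algl gen_idealMl //.
by apply/quot_classP; rewrite quot_class_repr.
Qed.

Lemma quot_mulA : associative quot_mul.
Proof.
move=> x y z; rewrite -[x]quot_class_repr -[y]quot_class_repr.
by rewrite -[z]quot_class_repr -!quot_class_mul mulrA.
Qed.

Lemma quot_mulC : commutative quot_mul.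
Proof. by move=> x y; rewrite /quot_mul mulrC. Qed.

Lemma quot_mul1 : left_id (quot_class 1) quot_mul.
Proof. by move=> x; rewrite -[x]quot_class_repr -quot_class_mul mul1r. Qed.

Lemma quot_mulDl : left_distributive quot_mul +%R.
Proof.
move=> x y z; rewrite -[x]quot_class_repr -[y]quot_class_repr.
rewrite -[z]quot_class_repr -raddfD -!quot_class_mul mulrDl.
exact: raddfD.
Qed.

HB.instance Definition _ := GRing.Zmodule_isComPzRing.Build ideal_quot
  quot_mulA quot_mulC quot_mul1 quot_mulDl.

Lemma quot_class_is_monoid_morphism : monoid_morphism quot_class.
Proof. by split=> // p q; apply: quot_class_mul. Qed.

HB.instance Definition _ :=
  GRing.isMonoidMorphism.Build A ideal_quot quot_class
    quot_class_is_monoid_morphism.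

Lemma quot_scaleA c d x : quot_scale c (quot_scale d x) = quot_scale (c * d) x.
Proof. by rewrite -[x]quot_class_repr -!quot_class_scale scalerA. Qed.

Lemma quot_scale1 : left_id 1 quot_scale.
Proof. by move=> x; rewrite -[x]quot_class_repr -quot_class_scale scale1r. Qed.

Lemma quot_scaleDr : right_distributive quot_scale +%R.
Proof.
move=> c x y; rewrite -[x]quot_class_repr -[y]quot_class_repr.
by rewrite -raddfD -!quot_class_scale scalerDr raddfD.
Qed.

Lemma quot_scaleDl x : {morph quot_scale^~ x : c d / c + d}.
Proof.
move=> c d; rewrite -[x]quot_class_repr -!quot_class_scale scalerDl.
exact: raddfD.
Qed.

HB.instance Definition _ := GRing.Zmodule_isLmodule.Build R ideal_quot
  quot_scaleA quot_scale1 quot_scaleDr quot_scaleDl.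

HB.instance Definition _ :=
  GRing.isScalable.Build R A ideal_quot *:%R quot_class quot_class_scale.

Lemma quot_scaleAl (c : R) (x y : ideal_quot) : c *: (x * y) = c *: x * y.
Proof.
rewrite -[x]quot_class_repr -[y]quot_class_repr.
have scaleE d p : d *: quot_class p = quot_class (d *: p).
  by rewrite quot_class_scale.
rewrite -rmorphM !scaleE -rmorphM; congr quot_class.
exact: scalerAl.
Qed.

End IdealQuotient.

Section Schur.
Variables (k : nat) (R : comNzRingType).

Definition mcomplete (d : nat) : {mpoly R[k]} :=
  \sum_(m : 'X_{1..k < d.+1} | mdeg m == d) 'X_[m].

Lemma mcoeff_mcomplete d (m : 'X_{1..k}) :
  (mcomplete d)@_m = (mdeg m == d)%:R.
Proof.
rewrite /mcomplete raddf_sum /=; case: eqP => [dm | dm].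
  have md : (mdeg m < d.+1)%N by rewrite dm.
  rewrite (bigD1 (BMultinom md)) /= ?dm // mcoeffX eqxx big1 ?addr0 // => x.
  by case/andP=> _ xm; rewrite mcoeffX [_ == m](negPf xm).
by rewrite big1 // => x /eqP dx; rewrite mcoeffX; case: eqP dm => // <-.
Qed.

Lemma mcomplete_sym d : @symmetric_pred k R (mcomplete d).
Proof.
apply/forallP => s; apply/eqP/mpolyP => m.
by rewrite mcoeff_sym !mcoeff_mcomplete mdeg_mperm.
Qed.

Definition hsym (m : int) : sympoly k R :=
  match m with
  | Posz d => SymPoly (mcomplete_sym d)
  | Negz _ => 0
  end.

(** [k]-tuples are functions on ['I_k], so the entry written [lambda_u] with
    [1 <= u <= k] on paper is [lambda] at the ordinal of value [u - 1]. *)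
Definition schur (lambda : {ffun 'I_k -> int}) : sympoly k R :=
  \det (\matrix_(u < k, v < k) hsym (lambda u - u%:Z + v%:Z)).

End Schur.

Definition is_partition (k : nat) (mu : {ffun 'I_k -> nat}) : Prop :=
  forall i j : 'I_k, (i <= j)%N -> (mu j <= mu i)%N.

Definition int_tuple (k : nat) (mu : {ffun 'I_k -> nat}) : {ffun 'I_k -> int} :=
  [ffun i => (mu i)%:Z].

Definition tuple_sum (k : nat) (tau : {ffun 'I_k -> int}) : int :=
  \sum_(i < k) tau i.

Definition Vset (n k : nat) : set {ffun 'I_k -> int} :=
  [set tau | forall i : 'I_k,
     if i == 0 :> nat then tau i = - n%:Z else tau i = 0 \/ tau i = 1].
Arguments Vset : clear implicits.

(** The sums [\sum_(tau \in A) _] of [fsbigop] are meaningful on finite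
    supports only. *)
Lemma finite_Vset n k : finite_set (Vset n k).
Proof.
pose f (b : {ffun 'I_k -> bool}) : {ffun 'I_k -> int} :=
  [ffun i : 'I_k => if i == 0 :> nat then - n%:Z else (b i : nat)%:Z].
apply: (@sub_finite_set _ _ (f @` setT)); last exact: finite_image.
move=> tau tauV; exists [ffun i => tau i == 1] => //.
apply/ffunP => i; rewrite !ffunE; move: (tauV i).
by case: ifP => // _ [] ->.
Qed.

(** [a j] and [Igens n a j] stand for [a_(j+1)] and [h_(n-k+j+1) - a_(j+1)],
    as ordinals start from 0. *)
Definition Igens (k n : nat) (R : comNzRingType) (a : 'I_k -> R) (j : 'I_k) :
    sympoly k R :=
  hsym k R (n%:Z - k%:Z + j.+1%:Z) - (a j)%:A.

(* Main.v *)
(** Row [u] of the Jacobi-Trudi matrix of [mu] is a window of [k] consecutive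
    terms of the sequence [h].  As [sum_j (-1)^j e_j h_(N-j) = 0] for [N > 0],
    this sequence satisfies a linear recurrence of order [k], so adding 1 to an
    entry of [mu] multiplies the row by the companion matrix [C].  For rows
    [w, v_2, ..., v_k], modulo [t^(n+1)],
    [det (w, v_2 (1 - tC), ..., v_k (1 - tC))
       = (sum_(i <= n) t^i det (w C^i, v_2, ..., v_k)) det (1 - tC)].
    For the windows of a unitriangular Jacobi-Trudi matrix this reads
    [1 = (sum_(i <= n) h_i t^i) det (1 - tC)].  Multiplying the general identity
    by [sum_i h_i t^i] and comparing the coefficients of [t^n] expands
    [det (w C^n, v_2, ..., v_k)], which gives
    [s_mu = sum_(tau in V) (-1)^(n + |tau|) h_(-|tau|) s_(mu + tau)] in
    the ring of symmetric polynomials; then [h_(n-k+j)] becomes [a_j] modulo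
    [I]. *)

Require Import Defs.
From HB Require Import structures.
From mathcomp Require Import all_boot all_order all_algebra.
From mathcomp Require Import classical_sets fsbigop.
From mathcomp Require Import freeg mpoly perm.
From mathcomp Require Import zify.

Set Implicit Arguments.
Unset Strict Implicit.
Unset Printing Implicit Defensive.

Import Order.TTheory GRing.Theory Num.Theory.

Local Open Scope classical_set_scope.
Local Open Scope ring_scope.

(** * Determinants whose top row is transformed separately *)

Section RowMixing.
Variables (A : comNzRingType) (K : nat).
Implicit Types (M S T U : 'M[A]_K.+1).

Definition mix_rows M S T : 'M[A]_K.+1 :=
  \matrix_(u, v) if u == ord0 then (M * S) u v else (M * T) u v.

Lemma mix_rowsM M S T U : mix_rows M S T * U = mix_rows M (S * U) (T * U).
Proof.
apply/matrixP => u v; rewrite [LHS]mxE [RHS]mxE !mulrA.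
by case: eqP => u0; rewrite [RHS]mxE; apply: eq_bigr => w _; rewrite mxE;
  case: eqP.
Qed.

Lemma det_mix_rows_linear M T a S1 S2 :
  \det (mix_rows M (a *: S1 + S2) T) =
  a * \det (mix_rows M S1 T) + \det (mix_rows M S2 T).
Proof.
have row0 S : row ord0 (mix_rows M S T) = row ord0 (M * S).
  by apply/rowP => v; rewrite [LHS]mxE mxE eqxx [RHS]mxE.
rewrite -[\det (mix_rows M S2 T)]mul1r; apply: (determinant_multilinear (i0 := ord0)).
- by rewrite !row0 scale1r mulrDr -scalerAr raddfD /= linearZ.
- by apply/matrixP => u v; rewrite !mxE eq_sym (negPf (neq_lift _ _)).
- by apply/matrixP => u v; rewrite !mxE eq_sym (negPf (neq_lift _ _)).
Qed.

Lemma det_mix_rows_sum M T (I : finType) (a : I -> A) (F : I -> 'M[A]_K.+1) :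
  \det (mix_rows M (\sum_i a i *: F i) T) =
  \sum_i a i * \det (mix_rows M (F i) T).
Proof.
have d0 : \det (mix_rows M 0 T) = 0.
  have := det_mix_rows_linear M T (-1) 0 0.
  by rewrite scaler0 addr0 mulN1r addNr.
rewrite (big_morph (fun S => \det (mix_rows M S T)) (id1 := 0) (op1 := +%R)) //.
  apply: eq_bigr => i _.
  by rewrite -[a i *: F i]addr0 det_mix_rows_linear d0 addr0.
by move=> S1 S2; rewrite -(scale1r S1) det_mix_rows_linear mul1r scale1r.
Qed.

End RowMixing.

(** * Geometric expansion along the top row *)

Section DetExpansion.
Variables (A : comNzRingType) (K : nat).
Implicit Types (M C : 'M[A]_K.+1).

Lemma map_polyC_mxM (M S : 'M[A]_K.+1) :
  map_mx polyC M * map_mx polyC S = map_mx polyC (M * S) :> 'M[{poly A}]_K.+1.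
Proof. by rewrite -[in RHS]/(M *m S) map_mxM. Qed.

(** With [T = X C], take the rows of [M], multiply the top one by [1 + T + ... + T^n], and then all
    rows by [1 - T]: the top factor telescopes to [1 - T^(n+1)], and linearity in the top row splits
    off the multiple of [X^(n+1)]. *)
Lemma det_mix_rows_geometric n M C : exists Q : {poly A},
  \det (mix_rows (map_mx polyC M) 1 (1 - 'X *: map_mx polyC C)) =
  (\poly_(i < n.+1) \det (mix_rows M (C ^+ i) 1)) *
    \det (1 - 'X *: map_mx polyC C) + 'X^(n.+1) * Q.
Proof.
set MP := map_mx _ M; set CP := map_mx _ C; set T := 'X *: CP.
have TX i : T ^+ i = 'X^i *: CP ^+ i.
  elim: i => [|i IH]; first by rewrite !expr0 scale1r.
  by rewrite !exprS IH -scalerAl -scalerAr scalerA.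
have CPX i : CP ^+ i = map_mx polyC (C ^+ i) by rewrite -rmorphXn.
exists (\det (mix_rows MP (CP ^+ n.+1) (1 - T))).
rewrite -[LHS](subrK ('X^(n.+1) * \det (mix_rows MP (CP ^+ n.+1) (1 - T)))).
congr (_ + _).
rewrite poly_def.
have -> : \sum_(i < n.+1) \det (mix_rows M (C ^+ i) 1) *: 'X^i =
    \det (mix_rows MP (\sum_(i < n.+1) T ^+ i) 1).
  under [in RHS]eq_bigr => i _ do rewrite TX.
  rewrite det_mix_rows_sum; apply: eq_bigr => i _.
  rewrite -mul_polyC mulrC; congr (_ * _).
  rewrite -det_map_mx CPX; congr (\det _).
  apply/matrixP => u v; rewrite [LHS]mxE [RHS]mxE mxE map_polyC_mxM !mulr1.
  by case: eqP => _; rewrite ?[RHS]mxE.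
rewrite -[RHS]det_mulmx -/(_ * _) mix_rowsM mul1r.
have -> : (\sum_(i < n.+1) T ^+ i) * (1 - T) = (- 'X^(n.+1)) *: CP ^+ n.+1 + 1.
  transitivity (1 - T ^+ n.+1); last by rewrite TX scaleNr addrC.
  rewrite -[RHS]opprB subrX1 -mulNr opprB.
  apply/commr_sym/commr_sum => i _; apply/commrX/commr_sym/commrB => //.
  exact: commr1.
by rewrite det_mix_rows_linear mulNr addrC.
Qed.

End DetExpansion.

(** * Expanding and rescaling the rows of a determinant *)

Lemma det_rowsD (B : comNzRingType) m (M N : 'M[B]_m) :
  \det (M + N) =
  \sum_(b : {ffun 'I_m -> bool})
    \det (\matrix_(u, v) if b u then N u v else M u v).
Proof.
rewrite /determinant exchange_big /=; apply: eq_bigr => s _.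
rewrite -big_distrr /=; congr (_ * _).
(* Each factor of a Leibniz term is a sum over a Boolean choice; distributing the product leaves one
   choice per row. *)
rewrite (eq_bigr (fun u => \sum_(c : bool) if c then N u (s u) else M u (s u))).
  rewrite bigA_distr_bigA; apply: eq_bigr => b _.
  by apply: eq_bigr => u _; rewrite mxE.
by move=> u _; rewrite big_bool mxE addrC.
Qed.

Lemma det_scale_rows (B : comNzRingType) m (d : 'I_m -> B) (M : 'M[B]_m) :
  \det (\matrix_(u, v) (d u * M u v)) = (\prod_u d u) * \det M.
Proof.
have -> : \matrix_(u, v) (d u * M u v) = diag_mx (\row_u d u) *m M.
  by rewrite mul_diag_mx; apply/matrixP => u v; rewrite !mxE.
by rewrite det_mulmx det_diag; congr (_ * _); apply: eq_bigr => u _; rewrite mxE.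
Qed.

Lemma sum_bool_le K (b : {ffun 'I_K.+1 -> bool}) :
  ~~ b ord0 -> (\sum_u b u <= K)%N.
Proof.
move=> b0; rewrite big_ord_recl (negPf b0) add0n.
rewrite -[K in (_ <= K)%N]card_ord -sum1_card.
by apply: leq_sum => i _; case: (b _).
Qed.

(** * Windows of a linearly recurrent sequence *)

Section LinearRecurrence.
Variables (A : comNzRingType) (K : nat) (g : nat -> A) (c : 'I_K.+1 -> A).
Hypothesis g_rec : forall p, g (p + K.+1) = \sum_(i < K.+1) c i * g (p + i).
Hypothesis g_lt : forall p, (p < K)%N -> g p = 0.
Hypothesis g_K : g K = 1.
Implicit Type p : 'I_K.+1 -> nat.

Definition shifts p : 'M[A]_K.+1 := \matrix_(u, v) g (p u + v).

(** Acts on windows from the right: the columns before the last shift by one place, the last applies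
    the recurrence. *)
Definition companion : 'M[A]_K.+1 :=
  \matrix_(i, j) if (j < K)%N then (i == j.+1 :> nat)%:R else c i.

Lemma shifts_companionX p i :
  shifts p * companion ^+ i = shifts (fun u => p u + i)%N.
Proof.
elim: i => [|i IH].
  by rewrite mulr1; apply/matrixP => u v; rewrite !mxE addn0.
rewrite exprSr mulrA IH; apply/matrixP => u v; rewrite !mxE.
under eq_bigr => w _ do rewrite !mxE.
case: ltnP => vK.
  have v1 : (v.+1 < K.+1)%N by [].
  rewrite (bigD1 (Ordinal v1)) //= eqxx mulr1 big1 ?addr0; first by congr g; lia.
  by move=> w wv; rewrite (negPf (_ : w != v.+1 :> nat)) ?mulr0 // -val_eqE.
have -> : v = K :> nat by have := ltn_ord v; lia.
rewrite (_ : p u + i.+1 + K = p u + i + K.+1)%N; last by lia.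
by rewrite g_rec; apply: eq_bigr => w _; rewrite mulrC.
Qed.

Definition update0 q p (u : 'I_K.+1) : nat := if u == ord0 then q else p u.

(** Starting at [g K = 1], this truncates the power series that turns out to be inverse to
    [delta]. *)
Let G n := \poly_(i < n.+1) g (K + i).
Let delta := \det (1 - 'X *: map_mx polyC companion).

Lemma det_shifts_geometric n q p : exists Q : {poly A},
  \det (mix_rows (map_mx polyC (shifts (update0 q p))) 1
     (1 - 'X *: map_mx polyC companion)) =
  (\poly_(i < n.+1) \det (shifts (update0 (q + i) p))) * delta + 'X^(n.+1) * Q.
Proof.
have [Q ->] := det_mix_rows_geometric n (shifts (update0 q p)) companion.
exists Q; congr (_ * _ + _); apply: eq_poly => i _; congr (\det _).
rewrite /mix_rows shifts_companionX mulr1; apply/matrixP => u v; rewrite !mxE.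
by rewrite /update0; case: eqP.
Qed.

(** As [g] vanishes below [K], the matrix is upper triangular with diagonal [g q, 1, ..., 1]. *)
Lemma shifts_unipotent_row0 q :
  \det (shifts (update0 q (fun u => K - u)%N)) = g q.
Proof.
rewrite -det_tr det_trig.
  rewrite big_ord_recl !mxE /update0 /= addn0 big1 ?mulr1 // => i _.
  by rewrite !mxE /= subnK // -ltnS.
apply/is_trig_mxP => u v uv; rewrite !mxE /update0 ifF ?g_lt //.
  by have := ltn_ord v; lia.
by apply/eqP => v0; rewrite v0 in uv.
Qed.

Lemma mix_shiftsE p : mix_rows (map_mx polyC (shifts p)) 1
    (1 - 'X *: map_mx polyC companion) =
  \matrix_(u, v) ((g (p u + v))%:P -
    if u == ord0 then 0 else 'X * (g (p u + 1 + v))%:P).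
Proof.
apply/matrixP => u v; rewrite [LHS]mxE [RHS]mxE mulrBr !mulr1 -scalerAr.
rewrite map_polyC_mxM -[companion]expr1 shifts_companionX.
by case: eqP => _; rewrite !mxE ?subr0.
Qed.

Lemma det_mix_shifts_unipotent :
  \det (mix_rows (map_mx polyC (shifts (update0 K (fun u => K - u)%N))) 1
     (1 - 'X *: map_mx polyC companion)) = 1.
Proof.
pose T0 := map_mx polyC (shifts (update0 K (fun u => K - u)%N)).
pose L : 'M[{poly A}]_K.+1 :=
  \matrix_(u, v) ((u == v)%:R - 'X * (u == v.+1 :> nat)%:R).
(* Multiplying row [u > 0] of [T0] by the companion matrix yields row [u - 1], so the row operation
   is left multiplication by the bidiagonal [L]. *)
have -> : mix_rows T0 1 (1 - 'X *: map_mx polyC companion) = L *m T0.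
  apply/matrixP => u v; rewrite mix_shiftsE !mxE.
  under eq_bigr => w _ do rewrite !mxE mulrBl -mulrA.
  rewrite sumrB (bigD1 u) //= eqxx mul1r [X in _ + X - _]big1 ?addr0; last first.
    by move=> w; rewrite eq_sym => /negPf->; rewrite mul0r.
  congr (_ - _); rewrite -mulr_sumr.
  case: eqP => [->|/eqP u0].
    by rewrite big1 ?mulr0 // => w _; rewrite mul0r.
  congr (_ * _).
  have uK := ltn_ord u; have u1 : (u.-1 < K.+1)%N by lia.
  have u_gt0 : (0 < u)%N by rewrite lt0n.
  rewrite (bigD1 (Ordinal u1)) //= prednK // eqxx mul1r big1 ?addr0; last first.
    move=> w wu; rewrite (negPf (_ : u != w.+1 :> nat)) ?mul0r //.
    by apply: contraNneq wu => uw; rewrite -val_eqE /= uw.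
  rewrite /update0 (negPf u0); congr (g _)%:P.
  by case: eqP => [/(congr1 val)|_] /=; lia.
rewrite det_mulmx det_map_mx shifts_unipotent_row0 g_K mulr1 det_trig.
  apply: big1 => i _; rewrite mxE eqxx (negPf (_ : i != i.+1 :> nat)).
    by rewrite mulr0 subr0.
  by rewrite neq_ltn ltnSn.
apply/is_trig_mxP => i j ij; rewrite !mxE -val_eqE /=.
by rewrite ltn_eqF // (@ltn_eqF i j.+1) ?mulr0 ?subr0 // ltnW.
Qed.

Lemma inverse_delta n : exists Q : {poly A}, 1 = G n * delta + 'X^(n.+1) * Q.
Proof.
have [Q] := det_shifts_geometric n K (fun u => K - u)%N.
rewrite det_mix_shifts_unipotent => e; exists Q; rewrite e; congr (_ * _ + _).
by apply: eq_poly => i _; rewrite shifts_unipotent_row0.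
Qed.

(** [b u] records whether row [u] contributes its window or [-X] times the next one; the top row
    offers only the former. *)
Lemma det_mix_shifts p :
  \det (mix_rows (map_mx polyC (shifts p)) 1
     (1 - 'X *: map_mx polyC companion)) =
  \sum_(b : {ffun 'I_K.+1 -> bool} | ~~ b ord0)
    ((-1) ^+ (\sum_u b u) * \det (shifts (fun u => p u + b u)%N)) *:
      'X^(\sum_u b u).
Proof.
pose N : 'M[{poly A}]_K.+1 :=
  \matrix_(u, v) if u == ord0 then 0 else - 'X * (g (p u + 1 + v))%:P.
have -> : mix_rows (map_mx polyC (shifts p)) 1
    (1 - 'X *: map_mx polyC companion) = map_mx polyC (shifts p) + N.
  rewrite mix_shiftsE; apply/matrixP => u v; rewrite !mxE; congr (_ + _).
  by case: eqP; rewrite ?oppr0 ?mulNr.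
rewrite det_rowsD [RHS]big_mkcond /=; apply: eq_bigr => b _.
pose d u : {poly A} := if b u then if u == ord0 then 0 else - 'X else 1.
transitivity ((\prod_u d u) * (\det (shifts (fun u => p u + b u)%N))%:P).
  rewrite -det_map_mx -det_scale_rows; congr (\det _); apply/matrixP => u v.
  rewrite !mxE /d; case: (b u); last by rewrite addn0 mul1r.
  by case: eqP; rewrite ?mul0r.
case b0: (b ord0) => /=.
  by rewrite (bigD1 ord0) //= /d b0 eqxx !mul0r.
rewrite (eq_bigr (fun u => (- 'X) ^+ b u)); last first.
  move=> u _; rewrite /d; case bu: (b u) => //.
  by case: eqP => // u0; rewrite u0 b0 in bu.
rewrite prodrXr -mul_polyC polyCM mulrAC.
congr (_ * _); rewrite (exprNn 'X); congr (_ * _).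
by apply/esym; exact: rmorph_sign.
Qed.

Lemma det_shifts_row0 n q p : (K <= n)%N ->
  \det (shifts (update0 (q + n) p)) =
  \sum_(b : {ffun 'I_K.+1 -> bool} | ~~ b ord0)
    (-1) ^+ (\sum_u b u) * g (K + (n - \sum_u b u)) *
      \det (shifts (fun u => update0 q p u + b u)%N).
Proof.
move=> Kn.
have [Q eN] := det_shifts_geometric n q p; have [Q' e1] := inverse_delta n.
set P := \poly_(i < n.+1) _ in eN.
have coefn (r : {poly A}) : ('X^(n.+1) * r)`_n = 0 by rewrite coefXnM ltnSn.
(* Modulo [X^(n+1)], [G n * delta] is 1, so this coefficient is that of [P], the determinant
   sought. *)
have : (G n * (P * delta + 'X^(n.+1) * Q))`_n = P`_n.
  rewrite mulrDr mulrA mulrAC -[in G n * delta](addrK ('X^(n.+1) * Q') (G n * delta)).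
  rewrite -e1 mulrBl mul1r [G n * _]mulrCA mulrAC !(coefD, coefN) -!mulrA !coefn.
  by rewrite oppr0 !addr0.
rewrite -eN [P`_n]coef_poly ltnSn => <-.
rewrite det_mix_shifts mulr_sumr coef_sum; apply: eq_bigr => b b0.
rewrite -scalerAr coefZ coefMXn.
(* At most [K] rows are shifted, so [n - \sum_u b u] is an exact subtraction. *)
have bn : (\sum_u b u <= n)%N.
  exact: leq_trans (sum_bool_le b0) Kn.
by rewrite ltnNge bn /= coef_poly ltnS leq_subr mulrAC.
Qed.

End LinearRecurrence.

(** * The relation between elementary and complete symmetric polynomials *)

Section CompleteElementary.
Variables (k : nat) (R : comNzRingType).

Definition esympoly (j : nat) : sympoly k R := SymPoly (mesym_sym k R j).

(** Negative [d] fits in: [h_d] is then 0, and [s <= m] rules out the degree equation. *)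
Lemma mcoeff_hsymMX (d : int) (s m : 'X_{1..k}) :
  ((hsym k R d : {mpoly R[k]}) * 'X_[s])@_m =
  ((s <= m)%MM && ((mdeg m)%:Z == d + (mdeg s)%:Z))%:R.
Proof.
have [sm|sm] /= := boolP (s <= m)%MM; last first.
  apply/eqP; rewrite mcoeff_eq0 (perm_mem (msuppMX _ _)).
  by apply/negP => /mapP[m' _ mE]; rewrite mE lem_addr in sm.
have dm : mdeg m = (mdeg (m - s) + mdeg s)%N by rewrite -mdegD submK.
rewrite -[in LHS](submK sm) addmC mcoeffMX dm; case: d => d /=.
  rewrite mcoeff_mcomplete; congr (_%:R); lia.
by rewrite mcoeff0 (_ : _ == _ = false) //; lia.
Qed.

(** The squarefree divisors of [X^m] correspond to the subsets of its support, whose signed count is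
    [\prod_i (1 - [m_i > 0])]; any variable in the support gives a zero factor. *)
Lemma sum_sign_mesym1_le (m : 'X_{1..k}) : m != 0%MM ->
  \sum_(S : {set 'I_k}) (-1) ^+ #|S| * (mesym1 S <= m)%MM%:R = 0 :> R.
Proof.
move=> m0.
have [i mi] : exists i, m i != 0%N.
  apply/existsP; apply: contraR m0 => /existsPn m0.
  by apply/eqP/mnmP => i; rewrite mnm0E; apply/eqP; rewrite -[_ == _]negbK.
transitivity (\prod_(i < k) (- (0 < m i)%N%:R + 1) : R); last first.
  by rewrite (bigD1 i) //= lt0n mi addNr mul0r.
rewrite bigA_distr; apply: eq_bigr => S _.
have [/mnm_lepP Sm | Sm] := boolP (mesym1 S <= m)%MM.
  rewrite mulr1 -prodr_const big_mkcond; apply: eq_bigr => j _.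
  by case: ifP => // jS; have := Sm j; rewrite mnmE jS => ->.
have /exists_inP[j jS /eqP mj] : [exists j in S, m j == 0%N].
  apply: contraR Sm => /exists_inPn Sm.
  apply/mnm_lepP => j; rewrite mnmE; case: (boolP (j \in S)) => // /Sm.
  by rewrite lt0n.
by rewrite mulr0 (bigD1 j) //= jS mj oppr0 mul0r.
Qed.

Lemma sum_esympoly_hsym (N : nat) : (0 < N)%N ->
  \sum_(j < k.+1) (-1) ^+ j *: (esympoly j * hsym k R (N%:Z - j%:Z)) = 0.
Proof.
move=> N0; apply: val_inj; rewrite rmorph0 rmorph_sum.
transitivity (\sum_(S : {set 'I_k}) (-1) ^+ #|S| *:
  ((hsym k R (N%:Z - #|S|%:Z) : {mpoly R[k]}) * 'X_[mesym1 S])).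
  have Sk (S : {set 'I_k}) : (#|S| < k.+1)%N.
    by rewrite ltnS -[k in (_ <= k)%N]card_ord max_card.
  rewrite [RHS](partition_big (fun S => Ordinal (Sk S)) predT) //=.
  apply: eq_bigr => j _; rewrite mesymE mulrC mulr_sumr.
  rewrite scaler_sumr; apply: eq_big => [S|S /eqP->] //.
apply/mpolyP => m; rewrite mcoeff0 raddf_sum /=.
(* The degree of the squarefree monomial offsets the index [N - #|S|], so the degree condition is
   [mdeg m = N] for every [S]. *)
under eq_bigr => S _ do rewrite mcoeffZ mcoeff_hsymMX mdeg_mesym1 subrK andbC.
case: eqP => [[mN]|_]; last by rewrite big1 // => S _; rewrite mulr0.
by apply: sum_sign_mesym1_le; rewrite -mdeg_eq0 mN -lt0n.
Qed.

End CompleteElementary.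

(** * Expansion of [s_mu] in the ring of symmetric polynomials *)

Section SchurExpansion.
Variables (K : nat) (R : comNzRingType).
Local Notation h := (hsym K.+1 R).

(* The shift by [K] makes every index that occurs a natural number. *)
Let g (p : nat) := h (p%:Z - K%:Z).

(** Comes from solving the relation between [e] and [h] for its leading [h]; moving the other terms
    across turns [(-1)^(K+1-i)] into [(-1)^(K-i)]. *)
Let c (i : 'I_K.+1) : sympoly K.+1 R :=
  (-1) ^+ (K - i) *: esympoly K.+1 R (K.+1 - i).

Lemma hsym_shift_lt p : (p < K)%N -> g p = 0.
Proof.
by rewrite /g => pK; case E: (_ - _) => [d|d] //; lia.
Qed.

Lemma hsym_shift0 : g K = 1.
Proof.
rewrite /g subrr; apply: val_inj; rewrite rmorph1 /=; apply/mpolyP => m.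
by rewrite mcoeff_mcomplete mcoeff1 mdeg_eq0.
Qed.

Lemma hsym_shift_rec p : g (p + K.+1) = \sum_(i < K.+1) c i * g (p + i).
Proof.
have := sum_esympoly_hsym K.+1 R (ltn0Sn p).
rewrite big_ord_recl expr0 scale1r subr0 [esympoly _ _ _](_ : _ = 1); last first.
  by apply: val_inj; rewrite rmorph1; apply: mesym0E.
rewrite mul1r => /eqP; rewrite addr_eq0 => /eqP e.
rewrite /g (_ : (p + K.+1)%:Z - K%:Z = p.+1%:Z); last by lia.
rewrite e -sumrN (reindex_inj rev_ord_inj) /=; apply: eq_bigr => i _.
have iK := ltn_ord i.
rewrite /c -scalerAl (_ : bump 0 _ = K.+1 - i)%N; last by rewrite /bump; lia.
rewrite (subSn (_ : i <= K)%N) // exprS mulN1r scaleNr opprK.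
by congr (_ *: (_ * h _)); lia.
Qed.

Lemma schur_shifts (lambda : {ffun 'I_K.+1 -> int}) (p : 'I_K.+1 -> nat) :
  (forall u, lambda u - u%:Z + K%:Z = (p u)%:Z) ->
  schur R lambda = \det (shifts g p).
Proof.
move=> lp; congr (\det _); apply/matrixP => u v; rewrite !mxE /g.
by congr (h _); have := lp u; lia.
Qed.

(** Bit vectors with [b ord0] false parametrise [V] bijectively, with [|tau| = |b| - n]. *)
Definition Vset_tuple (n : nat) (b : {ffun 'I_K.+1 -> bool}) :
    {ffun 'I_K.+1 -> int} :=
  [ffun u => if u == ord0 then - n%:Z else (b u)%:Z].

Lemma schur_expansion (n : nat) (mu : {ffun 'I_K.+1 -> nat}) :
  (K < n)%N -> (n - K.+1 < mu ord0)%N ->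
  schur R (int_tuple mu) =
  \sum_(b : {ffun 'I_K.+1 -> bool} | ~~ b ord0)
    (-1) ^+ (\sum_u b u) *: (h (n%:Z - (\sum_u b u)%:Z) *
      schur R (int_tuple mu + Vset_tuple n b)).
Proof.
move=> Kn mu_n.
pose p (u : 'I_K.+1) := (mu u + K - u)%N.
(* The bound on [mu ord0] makes this subtraction exact: the top row starts at [q + n] for [mu] and
   at [q] for [mu + tau]. *)
pose q := (mu ord0 + K - n)%N.
rewrite (@schur_shifts _ (update0 (q + n) p)); last first.
  move=> u; rewrite ffunE /update0 /p /q; have := ltn_ord u.
  by case: eqP => [->|_] /=; lia.
rewrite (det_shifts_row0 hsym_shift_rec hsym_shift_lt hsym_shift0 _ _ (ltnW Kn)).
apply: eq_bigr => b b0; rewrite -mulrA.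
have bn : (\sum_u b u <= n)%N by apply: leq_trans (ltnW Kn); exact: sum_bool_le.
rewrite (@schur_shifts _ (fun u => update0 q p u + b u)%N); last first.
  move=> u; rewrite !ffunE /update0 /p /q; have := ltn_ord u.
  by case: eqP => [->|_] /=; rewrite ?(negPf b0); lia.
rewrite -[in LHS]signr_odd mulr_sign -scaler_sign signr_odd.
by congr (_ *: (h _ * _)); rewrite PoszD -subzn // addrAC subrr add0r.
Qed.

End SchurExpansion.

(** * Passage to the quotient by [I] *)

Theorem theorem11p12 (R : comNzRingType) (k n : nat) (hk : (0 < k)%N)
    (hkn : (k <= n)%N) (a : 'I_k -> R) (mu : {ffun 'I_k -> nat})
    (mu_part : is_partition mu) (mu1 : (n - k < mu (Ordinal hk))%N) :
  quot_class (Igens n a) (schur R (int_tuple mu)) =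
  \sum_(j < k) (-1) ^+ (k - j.+1) *: (a j *:
    \sum_(tau \in Vset n k `&`
            [set tau | - tuple_sum tau = n%:Z - k%:Z + j.+1%:Z])
      quot_class (Igens n a) (schur R (int_tuple mu + tau))).
Proof.
case: k hk hkn a mu mu_part mu1 => // K hk hkn a mu _.
rewrite (_ : Ordinal hk = ord0); last exact: val_inj.
move=> mu1; rewrite (schur_expansion R hkn mu1) raddf_sum.
have bK (b : {ffun 'I_K.+1 -> bool}) : (K - \sum_u b u < K.+1)%N.
  by rewrite ltnS leq_subr.
(* The ordinal [j] stands for [j + 1] on paper, and [n - k + j + 1 = n - |b|] means
   [|b| = K - j]. *)
rewrite (partition_big (fun b => Ordinal (bK b)) predT) //=.
apply: eq_bigr => j _; rewrite subSS.
pose P (b : {ffun 'I_K.+1 -> bool}) := ~~ b ord0 && (\sum_u b u == K - j)%N.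
have jK : (j <= K)%N by rewrite -ltnS.
rewrite (eq_bigl P); last first.
  move=> b; rewrite /P; case b0: (b ord0) => //=; rewrite -val_eqE /=.
  by move: (\sum_u b u)%N (sum_bool_le (negbT b0)) => s sK; lia.
rewrite (@reindex_fsbig _ _ _ _ _ (Vset_tuple n) [set` enum P]).
  rewrite -fsbig_seq ?enum_uniq // big_enum !scaler_sumr.
  apply: eq_bigr => b /andP[_ /eqP ->].
  rewrite linearZ rmorphM /=; congr (_ *: _).
  rewrite (_ : quot_class _ (hsym _ _ _) = quot_class (Igens n a) (a j)%:A).
    by rewrite -rmorphM mulr_algl; apply: linearZ.
  (* The two differ by the generator [Igens n a j], hence the indicator of [j] as coefficients. *)
  apply/quot_classP/gen_idealP; exists (fun i => (i == j)%:R); rewrite /=.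
  rewrite (bigD1 j) //= eqxx mul1r big1 ?addr0 => [|i /negPf->].
    by rewrite /Igens; congr (_ - _); congr (hsym _ _ _); lia.
  exact: mul0r.
have strip_sum (b : {ffun 'I_K.+1 -> bool}) : ~~ b ord0 ->
    tuple_sum (Vset_tuple n b) = (\sum_u b u)%N%:Z - n%:Z.
  move=> b0; rewrite /tuple_sum big_ord_recl [in RHS]big_ord_recl ffunE eqxx.
  rewrite (negPf b0) add0n addrC; congr (_ - _).
  by rewrite (big_morph _ PoszD (erefl _)); apply: eq_bigr => u _; rewrite ffunE.
(* The bit vectors of weight [K - j] biject with this slice of [V]: image, injectivity,
   surjectivity. *)
split.
- move=> b /=; rewrite mem_enum => /andP[b0 /eqP bj]; split=> [u|/=].
    rewrite ffunE; have [->|u0] := eqVneq u ord0 => //.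
    rewrite ifF; last exact: negbTE.
    by case: (b u); [right | left].
  by rewrite strip_sum // bj; lia.
- move=> b b'; rewrite !inE /= !mem_enum => /andP[b0 _] /andP[b0' _] bb'.
  apply/ffunP => u; have := congr1 (fun f : {ffun _ -> int} => f u) bb'.
  rewrite !ffunE; case: eqP => [-> _|_].
    by rewrite (negPf b0) (negPf b0').
  by case: (b u); case: (b' u).
- move=> tau [tauV /= tau_sum]; pose b := [ffun u => (u != ord0) && (tau u == 1)].
  have tauE : Vset_tuple n b = tau.
    apply/ffunP => u; rewrite !ffunE; have := tauV u; rewrite -!val_eqE /=.
    by case: eqP => /= [_ -> //|_ [] ->].
  have b0 : ~~ b ord0 by rewrite ffunE eqxx.
  exists b => //=; rewrite mem_enum; apply/andP; split=> //.
  by move: tau_sum; rewrite -tauE strip_sum // => tau_sum; lia.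
Qed.
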